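(* Let $\mathbb{F}=\mathbb{R}$ or $\mathbb{C}$, $n\ge1$, let $A,B\in\mathbb{F}^{n\times n}$, and let $\mathcal{S},\mathcal{S}'$ be linear subspaces of $\mathbb{F}^n$. Then: (i) $\mathrm{Ind}_A(\mathcal{S}+\mathcal{S}')\le\mathrm{Ind}_A(\mathcal{S})+\mathrm{Ind}_A(\mathcal{S}')$. (ii) $\mathrm{Ind}_{A+B}(\mathcal{S})\le\mathrm{Ind}_A(\mathcal{S})+\mathrm{Ind}_B(\mathcal{S})$. (iii) $\mathrm{Ind}_{AB}(\mathcal{S})\le\mathrm{Ind}_A(\mathcal{S})+\mathrm{Ind}_B(\mathcal{S})$.
   Context: The index of invariance of a subspace $\mathcal{S}\subseteq\mathbb{F}^n$ with respect to $A\in\mathbb{F}^{n\times n}$ is $\mathrm{Ind}_A(\mathcal{S}):=\dim(\mathcal{S}+A\mathcal{S})-\dim(\mathcal{S})$, where $A\mathcal{S}=\{Ax:x\in\mathcal{S}\}$. *)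

(* Defs.v *)
From HB Require Import structures.
From mathcomp Require Import all_boot all_order all_algebra.
From mathcomp Require Import reals complex.

Set Implicit Arguments.
Unset Strict Implicit.
Unset Printing Implicit Defensive.

Import GRing.Theory.
Local Open Scope ring_scope.

Variant scalar_kind := RealScalars | ComplexScalars.

Definition scalars (R : realType) (k : scalar_kind) : fieldType :=
  match k with
  | RealScalars => R
  | ComplexScalars => R[i]
  end.

Definition mximg (F : fieldType) (n : nat) (A : 'M[F]_n)
    (S : {vspace 'cV[F]_n}) : {vspace 'cV[F]_n} :=
  (linfun (mulmx A) @: S)%VS.

Lemma mximgP (F : fieldType) (n : nat) (A : 'M[F]_n)
    (S : {vspace 'cV[F]_n}) (y : 'cV[F]_n) :
  reflect (exists2 x, x \in S & y = A *m x) (y \in mximg A S).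
Proof.
apply: (iffP memv_imgP) => -[x xS ->]; exists x => //; by rewrite lfunE.
Qed.

(* The subtraction is on nat, but it never truncates: see [ind_inv_addn]. *)
Definition ind_inv (F : fieldType) (n : nat) (A : 'M[F]_n)
    (S : {vspace 'cV[F]_n}) : nat :=
  (\dim (S + mximg A S)%VS - \dim S)%N.

Lemma ind_inv_addn (F : fieldType) (n : nat) (A : 'M[F]_n)
    (S : {vspace 'cV[F]_n}) :
  (ind_inv A S + \dim S)%N = \dim (S + mximg A S)%VS.
Proof. by rewrite subnK // dimvS // addvSl. Qed.

(* Main.v *)
Require Import Defs.
From HB Require Import structures.
From mathcomp Require Import all_boot all_order all_algebra.
From mathcomp Require Import reals complex.

Set Implicit Arguments.
Unset Strict Implicit.
Unset Printing Implicit Defensive.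

Import GRing.Theory.
Local Open Scope ring_scope.

(** Ind_A(S) is the least dimension of a subspace W with AS contained in S + W.
    Each inequality follows by combining optimal such W: for a product, if
    AS <= S + W and BS <= S + W', then ABS <= AS + AW' <= S + (W + AW'), and
    dim AW' <= dim W'. *)

Section IndexOfInvariance.

Variables (F : fieldType) (n : nat).
Implicit Types (A B : 'M[F]_n) (S T W : {vspace 'cV[F]_n}).

Lemma mximgS A S T : (S <= T -> mximg A S <= mximg A T)%VS.
Proof. exact: limgS. Qed.

Lemma mximgDr A S T : mximg A (S + T)%VS = (mximg A S + mximg A T)%VS.
Proof. exact: limgD. Qed.

(** Only an inclusion: on the left both matrices act on the same vector, while the sum on the right
    lets the two vectors vary independently. *)
Lemma mximgDl A B S : (mximg (A + B) S <= mximg A S + mximg B S)%VS.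
Proof.
apply/subvP => _ /mximgP[x xS ->]; rewrite mulmxDl.
by apply: memv_add; apply/mximgP; exists x.
Qed.

Lemma mximgM A B S : mximg (A *m B) S = mximg A (mximg B S).
Proof.
apply/vspaceP => y; apply/mximgP/mximgP => [[x xS ->]|[_ /mximgP[x xS ->] ->]].
  by exists (B *m x); [apply/mximgP; exists x | rewrite mulmxA].
by exists x; rewrite ?mulmxA.
Qed.

(** Rank-nullity for [A] restricted to [S]. *)
Lemma dim_mximg_le A S : (\dim (mximg A S) <= \dim S)%N.
Proof. by rewrite -(limg_ker_dim (linfun (mulmx A)) S) leq_addl. Qed.

(** [S + AS] lies in [S + W], whose dimension is at most [\dim S + \dim W]. *)
Lemma ind_inv_le A S W : (mximg A S <= S + W)%VS -> (ind_inv A S <= \dim W)%N.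
Proof.
move=> sASW; rewrite leq_subLR; apply: leq_trans (dimv_add_leqif S W).
by apply: dimvS; rewrite subv_add addvSl.
Qed.

(** A complement of [S] in [S + AS] attains the bound of [ind_inv_le]. *)
Lemma ind_inv_witness A S :
  exists2 W, (mximg A S <= S + W)%VS & \dim W = ind_inv A S.
Proof.
exists ((S + mximg A S) :\: S)%VS.
  by rewrite addvC addv_diff (subv_trans (addvSr S _)) ?addvSl.
apply/eqP; rewrite -(eqn_add2r (\dim S)) ind_inv_addn.
(* Writing [S] as [(S + AS) :&: S] gives the shape in which intersection and complement dimensions
   add up. *)
by rewrite addnC -{1}(capv_idPr (addvSl S (mximg A S))) dimv_cap_compl.
Qed.

Lemma ind_inv_addv A S T :
  (ind_inv A (S + T)%VS <= ind_inv A S + ind_inv A T)%N.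
Proof.
have [[W sW <-] [W' sW' <-]] := (ind_inv_witness A S, ind_inv_witness A T).
apply: leq_trans (dimv_add_leqif W W'); apply: ind_inv_le.
(* Regroup [(S + T) + (W + W')] as [(S + W) + (T + W')]. *)
by rewrite mximgDr Monoid.mulmACA addvS.
Qed.

Lemma ind_inv_addmx A B S :
  (ind_inv (A + B) S <= ind_inv A S + ind_inv B S)%N.
Proof.
have [[W sW <-] [W' sW' <-]] := (ind_inv_witness A S, ind_inv_witness B S).
apply: leq_trans (dimv_add_leqif W W'); apply: ind_inv_le.
apply: subv_trans (mximgDl A B S) _.
(* Doubling the right-hand [S] to [S + S] lets each of [W], [W'] be paired with its own copy. *)
by rewrite -{3}(addvv S) Monoid.mulmACA addvS.
Qed.

Lemma ind_inv_mulmx A B S :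
  (ind_inv (A *m B) S <= ind_inv A S + ind_inv B S)%N.
Proof.
have [[W sW <-] [W' sW' <-]] := (ind_inv_witness A S, ind_inv_witness B S).
(* The witness uses [AW'] in place of [W'], because [A] is applied to all of [S + W']. *)
apply: (@leq_trans (\dim (W + mximg A W'))); last first.
  by apply: leq_trans (dimv_add_leqif _ _) _; rewrite leq_add2l dim_mximg_le.
apply: ind_inv_le; rewrite mximgM; apply: subv_trans (mximgS A sW') _.
by rewrite mximgDr addvA addvS.
Qed.

End IndexOfInvariance.

Theorem lemma2p19 (R : realType) (k : scalar_kind) (n : nat) (hn : (1 <= n)%N)
    (A B : 'M[scalars R k]_n) (S S' : {vspace 'cV[scalars R k]_n}) :
  [/\ (ind_inv A (S + S')%VS <= ind_inv A S + ind_inv A S')%N,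
      (ind_inv (A + B) S <= ind_inv A S + ind_inv B S)%N &
      (ind_inv (A *m B) S <= ind_inv A S + ind_inv B S)%N].
Proof.
by split; [exact: ind_inv_addv | exact: ind_inv_addmx | exact: ind_inv_mulmx].
Qed.
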